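(* For every $q\in 2\mathbb{Z}$, the Block Lie superalgebra $\mathcal{S}(q)$ admits non-trivial $\mathrm{Hom}$-Lie superalgebra structures.
   Context: All algebras are over $\mathbb{C}$ and all linear maps are $\mathbb{C}$-linear. For $q\in\mathbb{C}$, the Block Lie superalgebra $\mathcal{S}(q)=\mathcal{S}(q)_0\oplus\mathcal{S}(q)_1$ is the complex Lie superalgebra whose even part has basis $\{L_{m,i}\mid m,i\in\mathbb{Z}\}$, whose odd part has basis $\{G_{m,i}\mid m,i\in\mathbb{Z}\}$, with brackets $[L_{m,i},L_{n,j}]=(n(i+q)-m(j+q))L_{m+n,i+j}$, $[L_{m,i},G_{n,j}]=\left(n(i+q)-m\left(j+\frac q2\right)\right)G_{m+n,i+j}$, $[G_{m,i},G_{n,j}]=2qL_{m+n,i+j}$ (and $[G_{n,j},L_{m,i}]=-[L_{m,i},G_{n,j}]$). A $\mathrm{Hom}$-Lie superalgebra structure on a Lie superalgebra $(\mathfrak{L}=\mathfrak{L}_0\oplus\mathfrak{L}_1,[\cdot,\cdot])$ is a homogeneous (even or odd) linear map $\varphi:\mathfrak{L}\to\mathfrak{L}$ such that $(-1)^{|x||z|}[\varphi(x),[y,z]]+(-1)^{|y||x|}[\varphi(y),[z,x]]+(-1)^{|z||y|}[\varphi(z),[x,y]]=0$ for all $x,y,z\in\mathfrak{L}_0\cup\mathfrak{L}_1$. It is non-trivial if $\varphi$ is not a scalar multiple of the identity map (in particular $\varphi\ne0$). *)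

(* Defs.v *)
(* Everything is over a numFieldType F; the complex numbers are the instance
   F = R[i] with R : realType. *)
From HB Require Import structures.
From mathcomp Require Import all_boot all_order all_algebra.
From mathcomp Require Import finmap monalg.
From mathcomp Require Import reals complex.
From mathcomp Require Import ring.

Set Implicit Arguments.
Unset Strict Implicit.
Unset Printing Implicit Defensive.

Import Order.TTheory GRing.Theory Num.Theory.
Local Open Scope ring_scope.

(* A Z/2-graded space is represented by the product V0 * V1; parities are
   booleans (false = even, true = odd), added by (+) and multiplied by &&.
   The zero vector is homogeneous of both parities. *)
Definition homogeneous (F : numFieldType) (V0 V1 : lmodType F) (b : bool)
  (x : V0 * V1) : Prop := if b then x.1 = 0 else x.2 = 0.

Record lieSuperalgebra (F : numFieldType) := LieSuperalgebra {
  even_part : lmodType F;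
  odd_part : lmodType F;
  bracket : (even_part * odd_part)%type -> (even_part * odd_part)%type ->
            (even_part * odd_part)%type;
  bracket_linearl : forall y, linear (bracket^~ y);
  bracket_linearr : forall x, linear (bracket x);
  bracket_graded : forall a b x y, homogeneous a x -> homogeneous b y ->
    homogeneous (a (+) b) (bracket x y);
  bracket_supersym : forall a b x y, homogeneous a x -> homogeneous b y ->
    bracket x y = - ((-1) ^+ (a && b) *: bracket y x);
  bracket_jacobi : forall a b c x y z,
    homogeneous a x -> homogeneous b y -> homogeneous c z ->
    (-1) ^+ (a && c) *: bracket x (bracket y z)
    + (-1) ^+ (b && a) *: bracket y (bracket z x)
    + (-1) ^+ (c && b) *: bracket z (bracket x y) = 0 }.

Definition lie_carrier (F : numFieldType) (A : lieSuperalgebra F) : lmodType F :=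
  (even_part A * odd_part A)%type.
Coercion lie_carrier : lieSuperalgebra >-> GRing.Lmodule.type.

Definition homogeneous_map (F : numFieldType) (A : lieSuperalgebra F)
  (phi : A -> A) : Prop :=
  exists d : bool, forall (b : bool) (x : A),
    homogeneous b x -> homogeneous (d (+) b) (phi x).

Definition hom_lie_structure (F : numFieldType) (A : lieSuperalgebra F)
  (phi : {linear A -> A}) : Prop :=
  homogeneous_map phi /\
  forall (a b c : bool) (x y z : A),
    homogeneous a x -> homogeneous b y -> homogeneous c z ->
    (-1) ^+ (a && c) *: bracket (phi x) (bracket y z)
    + (-1) ^+ (b && a) *: bracket (phi y) (bracket z x)
    + (-1) ^+ (c && b) *: bracket (phi z) (bracket x y) = 0.

Definition nontrivial (F : numFieldType) (A : lieSuperalgebra F)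
  (phi : {linear A -> A}) : Prop :=
  ~ exists c : F, forall x : A, phi x = c *: x.

Notation int2 := (int * int)%type.

(* {malg F[int2]} is the F-vector space with basis << (m, i) >>,
   m, i : int; convo c is the bilinear map sending (<< a >>, << b >>) to
   c a b *: << a + b >>. *)
HB.lock Definition convo {F : numFieldType} (c : int2 -> int2 -> F)
  (x y : {malg F[int2]}) : {malg F[int2]} :=
  \sum_(a <- msupp x) \sum_(b <- msupp y)
    (x@_a * y@_b * c a b) *: << a + b >>.

Definition block_LL (F : numFieldType) (q : F) (a b : int2) : F :=
  b.1%:~R * (a.2%:~R + q) - a.1%:~R * (b.2%:~R + q).

Definition block_LG (F : numFieldType) (q : F) (a b : int2) : F :=
  b.1%:~R * (a.2%:~R + q) - a.1%:~R * (b.2%:~R + q / 2).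

Definition block_GG (F : numFieldType) (q : F) (a b : int2) : F := 2 * q.

Definition block_bracket (F : numFieldType) (q : F)
  (x y : {malg F[int2]} * {malg F[int2]}) :
  {malg F[int2]} * {malg F[int2]} :=
  (convo (block_LL q) x.1 y.1 + convo (block_GG q) x.2 y.2,
   convo (block_LG q) x.1 y.2 - convo (block_LG q) y.1 x.2).

Lemma convow (F : numFieldType) (c : int2 -> int2 -> F)
  (x y : {malg F[int2]}) (d e : {fset int2}) :
  (msupp x `<=` d)%fset -> (msupp y `<=` e)%fset ->
  convo c x y =
  \sum_(a <- d) \sum_(b <- e) (x@_a * y@_b * c a b) *: << a + b >>.
Proof.
move=> hx hy; rewrite !convo.unlock (big_fset_incl _ hx) /=; last first.
  by move=> a _ /mcoeff_outdom ->; rewrite big1 // => b _; rewrite !mul0r scale0r.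
apply: eq_bigr => a _; rewrite (big_fset_incl _ hy) //=.
by move=> b _ /mcoeff_outdom ->; rewrite mulr0 mul0r scale0r.
Qed.

Lemma convo_linearr (F : numFieldType) (c : int2 -> int2 -> F)
  (x : {malg F[int2]}) : linear (convo c x).
Proof.
move=> k u v.
pose e := (msupp u `|` msupp v `|` msupp (k *: u + v))%fset.
have hu : (msupp u `<=` e)%fset by rewrite /e -fsetUA fsubsetUl.
have hv : (msupp v `<=` e)%fset by rewrite /e (fsetUC (msupp u)) -fsetUA fsubsetUl.
have hw : (msupp (k *: u + v) `<=` e)%fset by rewrite /e fsubsetUr.
rewrite (convow _ (fsubset_refl _) hu) (convow _ (fsubset_refl _) hv).
rewrite (convow _ (fsubset_refl _) hw) scaler_sumr -big_split /=.
apply: eq_bigr => a _; rewrite scaler_sumr -big_split /=.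
apply: eq_bigr => b _; rewrite [k *: (_ *: _)]scalerA.
rewrite -scalerDl (mcoeffD b (k *: u) v) (mcoeffZ k u b).
by rewrite mulrDr !mulrDl mulrCA !mulrA.
Qed.

Lemma convo_flip (F : numFieldType) (c : int2 -> int2 -> F)
  (x y : {malg F[int2]}) : convo c x y = convo (fun a b => c b a) y x.
Proof.
rewrite !convo.unlock exchange_big /=; apply: eq_bigr => a _; apply: eq_bigr => b _.
by rewrite addrC (mulrC x@_b).
Qed.

Lemma convo_linearl (F : numFieldType) (c : int2 -> int2 -> F)
  (y : {malg F[int2]}) : linear ((convo c)^~ y).
Proof. by move=> k u v; rewrite !(convo_flip _ _ y) convo_linearr. Qed.

Lemma convo0r (F : numFieldType) (c : int2 -> int2 -> F)
  (x : {malg F[int2]}) : convo c x 0 = 0.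
Proof. by rewrite !convo.unlock msupp0 big1 // => a _; rewrite big_seq_fset0. Qed.

Lemma convo0l (F : numFieldType) (c : int2 -> int2 -> F)
  (x : {malg F[int2]}) : convo c 0 x = 0.
Proof. by rewrite convo_flip convo0r. Qed.

Lemma convoNr (F : numFieldType) (c : int2 -> int2 -> F)
  (x y : {malg F[int2]}) : convo c x (- y) = - convo c x y.
Proof.
have := convo_linearr c x (-1) y 0.
by rewrite !scaleN1r convo0r !addr0.
Qed.

Lemma convoU (F : numFieldType) (c : int2 -> int2 -> F)
  (a b : int2) : convo c << a >> << b >> = c a b *: << a + b >>.
Proof.
rewrite !convo.unlock !msuppU oner_eq0 !big_seq_fset1.
by rewrite !mcoeffUU !mul1r.
Qed.

HB.lock Definition convo3 {F : numFieldType}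
  (e : int2 -> int2 -> int2 -> F)
  (x y z : {malg F[int2]}) : {malg F[int2]} :=
  \sum_(a <- msupp x) \sum_(b <- msupp y) \sum_(k <- msupp z)
    (x@_a * y@_b * z@_k * e a b k) *: << a + b + k >>.

Lemma convo_sumr (F : numFieldType) (c : int2 -> int2 -> F)
  (x : {malg F[int2]}) (I : Type) (r : seq I)
  (f : I -> {malg F[int2]}) :
  convo c x (\sum_(i <- r) f i) = \sum_(i <- r) convo c x (f i).
Proof.
apply: (big_morph (convo c x)) => [u v|]; last exact: convo0r.
by rewrite -{1}(scale1r u) convo_linearr scale1r.
Qed.

Lemma convoZr (F : numFieldType) (c : int2 -> int2 -> F)
  (x y : {malg F[int2]}) k : convo c x (k *: y) = k *: convo c x y.
Proof. by rewrite -[k *: y]addr0 convo_linearr convo0r addr0. Qed.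

Lemma convo_convo (F : numFieldType) (c d : int2 -> int2 -> F)
  (x y z : {malg F[int2]}) :
  convo c x (convo d y z) = convo3 (fun a b k => d b k * c a (b + k)) x y z.
Proof.
transitivity (\sum_(b <- msupp y) \sum_(k <- msupp z) \sum_(a <- msupp x)
    (x@_a * y@_b * z@_k * (d b k * c a (b + k))) *: << a + b + k >>).
  rewrite [X in convo c x X](_ : _ = \sum_(b <- msupp y) \sum_(k <- msupp z)
      (y@_b * z@_k * d b k) *: << b + k >>); last by rewrite convo.unlock.
  rewrite convo_sumr; apply: eq_bigr => b _.
  rewrite convo_sumr; apply: eq_bigr => k _.
  rewrite convoZr !convo.unlock scaler_sumr; apply: eq_bigr => a _.
  rewrite msuppU oner_eq0 big_seq_fset1 mcoeffUU scalerA addrA.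
  by congr (_ *: _); ring.
rewrite !convo3.unlock [RHS]exchange_big /=; apply: eq_bigr => b _.
exact: exchange_big.
Qed.

Lemma convo3_rot (F : numFieldType) e (x y z : {malg F[int2]}) :
  convo3 e y z x = convo3 (fun a b k => e b k a) x y z.
Proof.
rewrite !convo3.unlock [RHS]exchange_big /=; apply: eq_bigr => b _.
rewrite [RHS]exchange_big /=; apply: eq_bigr => k _.
apply: eq_bigr => a _; rewrite [a + b + k]addrC addrA [k + a + b]addrC addrA.
by congr (_ *: _); ring.
Qed.

Lemma convo3_swap (F : numFieldType) e (x y z : {malg F[int2]}) :
  convo3 e y x z = convo3 (fun a b k => e b a k) x y z.
Proof.
rewrite !convo3.unlock [RHS]exchange_big /=; apply: eq_bigr => b _.
apply: eq_bigr => a _; apply: eq_bigr => k _; rewrite [b + a]addrC.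
by congr (_ *: _); ring.
Qed.

Lemma convo_convol (F : numFieldType) (c d : int2 -> int2 -> F)
  (x y z : {malg F[int2]}) :
  convo c (convo d x y) z = convo3 (fun a b k => d a b * c (a + b) k) x y z.
Proof.
by rewrite convo_flip convo_convo (convo3_rot _ y z x) (convo3_rot _ x y z).
Qed.

Lemma convo3_sum0 (F : numFieldType) (s t : F) e1 e2 e3
  (x y z : {malg F[int2]}) :
  (forall a b k, e1 a b k + s * e2 a b k + t * e3 a b k = 0) ->
  convo3 e1 x y z + s *: convo3 e2 x y z + t *: convo3 e3 x y z = 0.
Proof.
move=> h; rewrite !convo3.unlock !scaler_sumr -!big_split /= big1 // => a _.
rewrite !scaler_sumr -!big_split /= big1 // => b _.
rewrite !scaler_sumr -!big_split /= big1 // => k _.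
rewrite !scalerA -!scalerDl.
rewrite (_ : _ + _ = x@_a * y@_b * z@_k *
    (e1 a b k + s * e2 a b k + t * e3 a b k)); last by ring.
by rewrite h mulr0 scale0r.
Qed.

Lemma block_jacobi_LLL (F : numFieldType) (q : F) (x y z : {malg F[int2]}) :
  convo (block_LL q) x (convo (block_LL q) y z)
  + convo (block_LL q) y (convo (block_LL q) z x)
  + convo (block_LL q) z (convo (block_LL q) x y) = 0.
Proof.
rewrite !convo_convo (convo3_rot _ y z x) !(convo3_rot _ x y z).
rewrite -[X in _ + X + _]scale1r -[X in _ + X]scale1r.
apply: convo3_sum0 => a b k; rewrite /block_LL /= !intrD; ring.
Qed.

Lemma block_jacobi_LLG (F : numFieldType) (q : F) (x y z : {malg F[int2]}) :
  convo (block_LG q) x (convo (block_LG q) y z)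
  - convo (block_LG q) y (convo (block_LG q) x z)
  - convo (block_LG q) (convo (block_LL q) x y) z = 0.
Proof.
rewrite convo_convol !convo_convo (convo3_swap _ x y z).
rewrite -[X in _ + X + _]scaleN1r -[X in _ + X]scaleN1r.
apply: convo3_sum0 => a b k; rewrite /block_LL /block_LG /= !intrD; by field.
Qed.

Lemma block_jacobi_LGG (F : numFieldType) (q : F) (x y z : {malg F[int2]}) :
  convo (block_LL q) x (convo (block_GG q) y z)
  - convo (block_GG q) y (convo (block_LG q) x z)
  - convo (block_GG q) z (convo (block_LG q) x y) = 0.
Proof.
rewrite !convo_convo (convo3_swap _ x y z) (convo3_rot _ y z x) (convo3_rot _ x y z).
rewrite -[X in _ + X + _]scaleN1r -[X in _ + X]scaleN1r.
apply: convo3_sum0 => a b k.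
rewrite /block_LL /block_LG /block_GG /= !intrD; by field.
Qed.

Lemma block_jacobi_GGG (F : numFieldType) (q : F) (x y z : {malg F[int2]}) :
  convo (block_LG q) (convo (block_GG q) y z) x
  + convo (block_LG q) (convo (block_GG q) z x) y
  + convo (block_LG q) (convo (block_GG q) x y) z = 0.
Proof.
rewrite !convo_convol.
rewrite (convo3_rot _ y z x) !(convo3_rot _ x y z).
rewrite -[X in _ + X + _]scale1r -[X in _ + X]scale1r.
apply: convo3_sum0 => a b k; rewrite /block_LG /block_GG /= !intrD; by field.
Qed.

Lemma block_bracket_linearl (F : numFieldType) (q : F)
  (y : {malg F[int2]} * {malg F[int2]}) : linear ((block_bracket q)^~ y).
Proof.
move=> k u v; rewrite /block_bracket /=; congr (_, _) => /=.
  by rewrite !convo_linearl scalerDr addrACA.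
by rewrite convo_linearl convo_linearr scalerBr opprD addrACA.
Qed.

Lemma block_bracket_linearr (F : numFieldType) (q : F)
  (x : {malg F[int2]} * {malg F[int2]}) : linear (block_bracket q x).
Proof.
move=> k u v; rewrite /block_bracket /=; congr (_, _) => /=.
  by rewrite !convo_linearr scalerDr addrACA.
by rewrite convo_linearl convo_linearr scalerBr opprD addrACA.
Qed.

Lemma block_bracket_graded (F : numFieldType) (q : F) a b
  (x y : {malg F[int2]} * {malg F[int2]}) :
  homogeneous a x -> homogeneous b y ->
  homogeneous (a (+) b) (block_bracket q x y).
Proof.
by case: x y a b => [x0 x1] [y0 y1] [] [] /= -> ->;
   rewrite ?convo0l ?convo0r ?subr0 ?addr0.
Qed.

Lemma block_LL_antisym (F : numFieldType) (q : F) (x y : {malg F[int2]}) :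
  convo (block_LL q) x y = - convo (block_LL q) y x.
Proof.
rewrite convo_flip !convo.unlock -sumrN; apply: eq_bigr => a _.
rewrite -sumrN; apply: eq_bigr => b _; rewrite -scaleNr.
have -> : block_LL q b a = - block_LL q a b by rewrite /block_LL; ring.
by rewrite mulrN.
Qed.

Lemma block_bracket_supersym (F : numFieldType) (q : F) a b
  (x y : {malg F[int2]} * {malg F[int2]}) :
  homogeneous a x -> homogeneous b y ->
  block_bracket q x y = - ((-1) ^+ (a && b) *: block_bracket q y x).
Proof.
case: x y a b => [x0 x1] [y0 y1] [] [] /= -> ->; rewrite /block_bracket /=;
  rewrite ?expr1 ?expr0 ?scaleN1r ?scale1r ?opprK;
  congr (_, _) => /=; rewrite ?convo0l ?convo0r ?(subr0, sub0r, addr0, add0r);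
  rewrite ?oppr0 ?opprK //.
- by rewrite convo_flip.
- exact: block_LL_antisym.
Qed.

Lemma block_bracket_jacobi (F : numFieldType) (q : F) a b c
  (x y z : {malg F[int2]} * {malg F[int2]}) :
  homogeneous a x -> homogeneous b y -> homogeneous c z ->
  (-1) ^+ (a && c) *: block_bracket q x (block_bracket q y z)
  + (-1) ^+ (b && a) *: block_bracket q y (block_bracket q z x)
  + (-1) ^+ (c && b) *: block_bracket q z (block_bracket q x y) = 0.
Proof.
case: x y z a b c => [x0 x1] [y0 y1] [z0 z1] [] [] [] /= -> -> ->;
  rewrite /block_bracket /= ?expr1 ?expr0 ?scaleN1r ?scale1r;
  congr (_, _) => /=;
  rewrite ?(convo0l, convo0r, subr0, sub0r, addr0, add0r, oppr0, convoNr) //=;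
  rewrite ?opprK ?(addr0, add0r) //.
- exact: block_jacobi_GGG.
- by rewrite addrC addrA block_jacobi_LGG.
- by rewrite -addrA addrC block_jacobi_LGG.
- by rewrite -addrA addrC block_jacobi_LLG.
- exact: block_jacobi_LGG.
- by rewrite addrC addrA block_jacobi_LLG.
- exact: block_jacobi_LLG.
- exact: block_jacobi_LLL.
Qed.

Definition block_superalgebra (F : numFieldType) (q : F) : lieSuperalgebra F :=
  LieSuperalgebra (block_bracket_linearl q) (block_bracket_linearr q)
    (@block_bracket_graded F q) (@block_bracket_supersym F q)
    (@block_bracket_jacobi F q).

Definition block_L (F : numFieldType) (q : F) (m i : int) :
  block_superalgebra q := (<< (m, i) >>, 0).

Definition block_G (F : numFieldType) (q : F) (m i : int) :
  block_superalgebra q := (0, << (m, i) >>).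

Lemma block_bracketLL (F : numFieldType) (q : F) (m i n j : int) :
  bracket (block_L q m i) (block_L q n j) =
  (n%:~R * (i%:~R + q) - m%:~R * (j%:~R + q)) *: block_L q (m + n) (i + j).
Proof.
rewrite /bracket /= /block_bracket /=; congr (_, _) => /=.
  by rewrite convoU convo0l addr0.
by rewrite !convo0r subrr scaler0.
Qed.

Lemma block_bracketLG (F : numFieldType) (q : F) (m i n j : int) :
  bracket (block_L q m i) (block_G q n j) =
  (n%:~R * (i%:~R + q) - m%:~R * (j%:~R + q / 2)) *: block_G q (m + n) (i + j).
Proof.
rewrite /bracket /= /block_bracket /=; congr (_, _) => /=.
  by rewrite convo0r convo0l addr0 scaler0.
by rewrite convoU convo0l subr0.
Qed.

Lemma block_bracketGG (F : numFieldType) (q : F) (m i n j : int) :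
  bracket (block_G q m i) (block_G q n j) =
  (2 * q) *: block_L q (m + n) (i + j).
Proof.
rewrite /bracket /= /block_bracket /=; congr (_, _) => /=.
  by rewrite convoU convo0l add0r.
by rewrite !convo0l subrr scaler0.
Qed.

(* Main.v *)
(** For an integer [q] the element [L_{0,-q}] is central in S(q), and any
    homogeneous linear map into the center is a Hom-Lie structure, because every
    term of the Hom-Jacobi identity vanishes. The map sending [x] to the
    [L_{0,0}]-coefficient of [x] times [L_{0,-q}] has rank one, so it is not
    scalar. *)
Require Import Defs.
From HB Require Import structures.
From mathcomp Require Import all_boot all_order all_algebra.
From mathcomp Require Import finmap monalg.
From mathcomp Require Import reals complex.
Import GRing.Theory.
Local Open Scope ring_scope.

Set Implicit Arguments.
Unset Strict Implicit.

Lemma convo_eq0 (F : numFieldType) (c : int2 -> int2 -> F)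
  (a : int2) (y : {malg F[int2]}) :
  (forall b, c a b = 0) -> convo c << a >> y = 0.
Proof.
move=> c0; rewrite convo.unlock msuppU oner_eq0 big_seq_fset1.
by rewrite big1 // => b _; rewrite c0 mulr0 scale0r.
Qed.

(** With [q = p], the index [(0, - p)] has [m = 0] and [i + q = 0]. Every term of [block_LL] and of
    [block_LG] contains one of these two factors, so both structure constants vanish. *)
Lemma block_L_central (F : numFieldType) (p : int)
  (y : block_superalgebra (p%:~R : F)) : bracket (block_L p%:~R 0 (- p)) y = 0.
Proof.
rewrite /bracket /= /block_bracket /= !convo0l convo0r addr0 subr0.
by congr (_, _); apply: convo_eq0 => b; rewrite /block_LL /block_LG /=;
  rewrite intrN addNr mulr0 mul0r subr0.
Qed.

Lemma bracketZl (F : numFieldType) (A : lieSuperalgebra F) (c : F) (x y : A) :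
  bracket (c *: x) y = c *: bracket x y.
Proof.
have bracket0l : bracket 0 y = 0.
  (* Linearity with scalar -1 at the zero vector makes the right-hand side cancel. *)
  have := bracket_linearl y (-1) (0 : A) 0.
  by rewrite scaler0 addr0 scaleN1r addNr.
by have := bracket_linearl y c x 0; rewrite !addr0 bracket0l addr0.
Qed.

Lemma central_hom_lie_structure (F : numFieldType) (A : lieSuperalgebra F)
  (phi : {linear A -> A}) :
  homogeneous_map phi -> (forall x y, bracket (phi x) y = 0) ->
  hom_lie_structure phi.
Proof.
move=> hphi phiC; split=> // a b c x y z _ _ _.
by rewrite !phiC !scaler0 !addr0.
Qed.

(** The vector [z] stays arbitrary here; its centrality enters only through the Hom-Jacobi
    identity. *)
Definition coefL00 (F : numFieldType) (q : F) (z : block_superalgebra q)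
  (x : block_superalgebra q) : block_superalgebra q := x.1@_(0, 0) *: z.

Lemma coefL00_linear (F : numFieldType) (q : F) (z : block_superalgebra q) :
  linear (coefL00 z).
Proof.
by move=> a x y; rewrite /coefL00 mcoeffD mcoeffZ scalerDl scalerA.
Qed.

HB.instance Definition _ (F : numFieldType) (q : F) (z : block_superalgebra q) :=
  GRing.isLinear.Build F (block_superalgebra q) (block_superalgebra q) *:%R
    (coefL00 z) (coefL00_linear z).

Lemma coefL00_homogeneous (F : numFieldType) (q : F) (z : block_superalgebra q) :
  homogeneous false z -> homogeneous_map (coefL00 z).
Proof.
(* The map is even: an odd [x] has no [L]-component and is killed, while an even [x] goes to a
   multiple of the even [z]. *)
move=> z0; exists false => -[] x /= hx; rewrite /coefL00 /=.
  by rewrite hx mcoeff0 scale0r.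
by rewrite z0 scaler0.
Qed.

Lemma coefL00_nontrivial (F : numFieldType) (q : F) (z : block_superalgebra q) :
  z != 0 -> nontrivial (coefL00 z).
Proof.
move=> /eqP z0 [c cE]; apply: z0.
have {}cE x : coefL00 z x = c *: x := cE x.
have c0 : c = 0.
  (* The odd vector [G_{0,0}] is killed, so its own coefficient in the image is both 0 and [c]. *)
  have := congr1 (fun x => x.2@_(0, 0)) (cE (block_G q 0 0)).
  rewrite /coefL00 (_ : (block_G q 0 0).1 = 0) // mcoeff0 scale0r.
  by rewrite mcoeff0 mcoeffZ mcoeffUU mulr1 => <-.
(* But [L_{0,0}] is sent to [z], so [c = 0] would force [z = 0]. *)
by have := cE (block_L q 0 0); rewrite c0 scale0r /coefL00 mcoeffUU scale1r.
Qed.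

Theorem corollary3p15 (R : realType) (q : R[i]) (k : int)
  (hq : q = (2 * k)%:~R) :
  exists phi : {linear block_superalgebra q -> block_superalgebra q},
    hom_lie_structure phi /\ nontrivial phi.
Proof.
subst q; set p := 2 * k; pose z := block_L (p%:~R : R[i]) 0 (- p).
exists (coefL00 z); split.
  apply: central_hom_lie_structure; first exact: coefL00_homogeneous.
  move=> x y; apply: (etrans (bracketZl _ z y)).
  by rewrite block_L_central scaler0.
(* [z] is a basis vector, with coefficient 1 at its own index. *)
apply: coefL00_nontrivial; apply/eqP => /(congr1 (fun x => x.1@_(0, - p))).
by rewrite /= mcoeffUU mcoeff0 => /eqP; rewrite oner_eq0.
Qed.
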